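(* Let $S_{\Lambda T\Gamma U}$ be the frame operator for the pair consisting of a continuous $(T,T)$-controlled $g$-fusion Bessel family $\Lambda_{TT}=\{(F(x),\Lambda_x,v(x))\}_{x\in X}$ with bound $B$ and a continuous $(U,U)$-controlled $g$-fusion Bessel family $\Gamma_{UU}=\{(G(x),\Gamma_x,w(x))\}_{x\in X}$ with bound $D$ for $H$. Then the following statements are equivalent: (i) $S_{\Lambda T\Gamma U}$ is bounded below. (ii) There exists a bounded linear operator $K$ on $H$ such that $\{T_x\}_{x\in X}$ is a continuous resolution of the identity operator on $H$, where $T_x=v(x)w(x)\,K\,U\,P_{G(x)}\Gamma_x^*\Lambda_xP_{F(x)}T$ for $x\in X$. If one of these conditions holds, then $\Lambda_{TT}$ is a continuous $(T,T)$-controlled $g$-fusion frame for $H$.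
   Context: $H$ is a separable Hilbert space, $\mathbb H$ is the collection of all closed subspaces of $H$, and $(X,\mu)$ is a measure space with positive measure $\mu$; $d\mu_x$ denotes integration with respect to $\mu$ in the variable $x$. $P_M$ is the orthogonal projection of $H$ onto a closed subspace $M$ (when followed by an operator defined on $M$ it is regarded as a map $H\to M$; its adjoint is then the inclusion $M\to H$). An operator is positive if it is self-adjoint and $\langle Sf,f\rangle\ge 0$ for all $f$; $\mathcal{GB}^+(H)$ is the set of positive bounded operators on $H$ with bounded inverse. Here $T,U\in\mathcal{GB}^+(H)$; $F,G:X\to\mathbb H$ are weakly measurable (for each $f\in H$, $x\mapsto P_{F(x)}f$ and $x\mapsto P_{G(x)}f$ are measurable); $v,w:X\to\mathbb R^+$ are measurable; $\{K_x\}_{x\in X}$ are Hilbert spaces; and $\Lambda_x:F(x)\to K_x$, $\Gamma_x:G(x)\to K_x$ are bounded linear for each $x\in X$. $\Lambda_{TT}$ is a continuous $(T,T)$-controlled $g$-fusion frame for $H$ if there are $0<A\le B<\infty$ with $A\|f\|^2\le\int_X v^2(x)\langle\Lambda_xP_{F(x)}Tf,\Lambda_xP_{F(x)}Tf\rangle\,d\mu_x\le B\|f\|^2$ for all $f\in H$; it is a Bessel family with bound $B$ if the right-hand inequality holds. Similarly for $\Gamma_{UU}$ with $G,\Gamma_x,w,U$ in place of $F,\Lambda_x,v,T$. The frame operator for the pair is the bounded operator $S_{\Lambda T\Gamma U}$ on $H$ defined by $\langle S_{\Lambda T\Gamma U}f,g\rangle=\int_X v(x)w(x)\langle UP_{G(x)}\Gamma_x^*\Lambda_xP_{F(x)}Tf,g\rangle\,d\mu_x$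 for $f,g\in H$. The integrands occurring here are understood to be measurable. An operator $S$ is bounded below if there is $M>0$ with $\|Sf\|\ge M\|f\|$ for all $f\in H$. A family $\{R_x\}_{x\in X}$ of bounded operators on $H$ is a continuous resolution of the identity operator on $H$ if for all $f,g\in H$ the function $x\mapsto\langle R_xf,g\rangle$ is measurable on $X$ and $\langle f,g\rangle=\int_X\langle R_xf,g\rangle\,d\mu_x$. *)

(* Defs.v *)
From HB Require Import structures.
From mathcomp Require Import all_boot all_order all_algebra.
From mathcomp Require Import sesquilinear.
From mathcomp Require Import all_classical all_reals all_analysis.
From mathcomp Require Import complex.

Set Implicit Arguments.
Unset Strict Implicit.
Unset Printing Implicit Defensive.
Import Order.TTheory GRing.Theory Num.Theory.
Import numFieldNormedType.Exports.
Local Open Scope classical_set_scope.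
Local Open Scope ring_scope.

(* The source does not fix the scalar field of its Hilbert spaces: everything
   below is uniform in a flag [k] selecting the reals or the complex numbers. *)
Variant scalarKind := RealScalars | ComplexScalars.

Definition scalar (R : realType) (k : scalarKind) : numFieldType :=
  match k with
  | RealScalars => R : numFieldType
  | ComplexScalars => R[i] : numFieldType
  end.

Section scalars.
Variables (R : realType) (k : scalarKind).

(* [a + b i]; over the reals the second argument, always 0 below, is dropped. *)
Definition mkK : R -> R -> scalar R k :=
  match k return R -> R -> scalar R k with
  | RealScalars => fun a _ => a
  | ComplexScalars => fun a b => Complex a b
  end.

Definition reK : scalar R k -> R :=
  match k return scalar R k -> R with
  | RealScalars => fun z => z
  | ComplexScalars => fun z => complex.Re z
  end.

Definition imK : scalar R k -> R :=
  match k return scalar R k -> R with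
  | RealScalars => fun _ => 0
  | ComplexScalars => fun z => complex.Im z
  end.

Definition ofR (r : R) : scalar R k := mkK r 0.

Definition conjK (z : scalar R k) : scalar R k := mkK (reK z) (- imK z).

End scalars.

(* Inner products are linear in the first argument and conjugate-linear in the
   second one; completeness is part of the base structure. *)
HB.mixin Record isHilbert (R : realType) (k : scalarKind) H
    & CompleteNormedModule (scalar R k) H := {
  inner : {dot H for @conjK R k} ;
  inner_norm : forall x : H, inner x x = `|x| ^+ 2 }.

#[short(type="hilbertType")]
HB.structure Definition Hilbert (R : realType) (k : scalarKind) :=
  {H of CompleteNormedModule (scalar R k) H & isHilbert R k H}.

Section closed_subspaces.
Variables (R : realType) (k : scalarKind) (H : hilbertType R k).

Record closedSubspace := ClosedSubspace {
  cs_set : set H ;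
  cs_submod : submod_closed (mem cs_set) ;
  cs_closed : closed cs_set }.
Arguments cs_closed : clear implicits.

(* The elements of a closed subspace [M]; they form a Hilbert space for the
   induced operations, norm and inner product.  (A fresh name, so that the
   topology is the one of the norm and not the library's initial topology on
   [set_type], from which it differs as a term.) *)
Definition cs_elt (M : closedSubspace) : Type := set_type (cs_set M).

HB.instance Definition _ (M : closedSubspace) := SubChoice.on (cs_elt M).
HB.instance Definition _ (M : closedSubspace) :=
  GRing.SubChoice_isSubLmodule.Build (scalar R k) H (mem (cs_set M)) (cs_elt M)
    (cs_submod M).

Section normed.
Variable M : closedSubspace.

Definition cs_norm (x : cs_elt M) : scalar R k := `|val x|.

Lemma cs_normD x y : cs_norm (x + y) <= cs_norm x + cs_norm y.
Proof. by rewrite /cs_norm raddfD ler_normD. Qed.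

Lemma cs_normZ l x : cs_norm (l *: x) = `|l| * cs_norm x.
Proof. by rewrite /cs_norm linearZ normrZ. Qed.

Lemma cs_norm_eq0 x : cs_norm x = 0 -> x = 0.
Proof. by move/normr0_eq0 => x0; apply: val_inj; rewrite x0 raddf0. Qed.

HB.instance Definition _ := Lmodule_isNormed.Build (scalar R k) (cs_elt M)
  cs_normD cs_normZ cs_norm_eq0.

Lemma cs_cauchy_cvg (F : set_system (cs_elt M)) :
  ProperFilter F -> cauchy F -> cvg F.
Proof.
move=> FF /cauchy_ballP Fc.
have /cauchy_cvg/cvg_ex[l Fl] : cauchy (fmap (val : cs_elt M -> H) F).
  apply/cauchy_ballP => e e0; rewrite near_map2.
  apply: filterS (Fc e e0) => -[x y]; rewrite -!ball_normE /=.
  by rewrite /Num.norm /= /cs_norm raddfB.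
have Ml : cs_set M l.
  have MF : \forall x \near F, cs_set M (val (x : cs_elt M)).
    by apply: nearW => x; exact/set_mem/valP.
  exact: (closed_cvg _ (cs_closed M) MF _ Fl).
apply/cvg_ex; exists (exist _ l (mem_set Ml) : cs_elt M).
apply/cvgrPdist_lt => e e0; move/cvgrPdist_lt : Fl => /(_ e e0) Fl.
apply: filterS Fl => x; rewrite {2}/Num.norm /= /cs_norm raddfB.
exact.
Qed.

HB.instance Definition _ := Uniform_isComplete.Build (cs_elt M) cs_cauchy_cvg.

Definition cs_inner (x y : cs_elt M) : scalar R k := inner (val x) (val y).

Lemma cs_inner_additivel y : zmod_morphism (cs_inner ^~ y).
Proof.
by move=> u v; rewrite /cs_inner (raddfB val); exact: zmod_morphisml_subproof.
Qed.

Lemma cs_inner_additiver x : zmod_morphism (cs_inner x).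
Proof.
by move=> u v; rewrite /cs_inner (raddfB val); exact: zmod_morphismr_subproof.
Qed.

Lemma cs_inner_scalel y : scalable_for *%R (cs_inner ^~ y).
Proof.
by move=> a u; rewrite /cs_inner [val (_ *: _)]linearZ; exact: linearl_subproof.
Qed.

Lemma cs_inner_scaler x : scalable_for (@conjK R k \; *%R) (cs_inner x).
Proof.
by move=> a u; rewrite /cs_inner [val (_ *: _)]linearZ; exact: linearr_subproof.
Qed.

Lemma cs_inner_herm x y :
  cs_inner x y = (-1) ^+ false * conjK (cs_inner y x).
Proof. exact: hermitian_subproof. Qed.

Lemma cs_inner_gt0 x : x != 0 -> 0 < cs_inner x x.
Proof.
move=> x0; apply: neq0_dnorm_gt0; apply: contra x0 => /eqP vx0.
by apply/eqP/val_inj; rewrite vx0 raddf0.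
Qed.

HB.instance Definition _ := isBilinear.Build (scalar R k) (cs_elt M)
  (cs_elt M) (scalar R k) *%R (@conjK R k \; *%R) cs_inner
  cs_inner_additivel cs_inner_additiver cs_inner_scalel cs_inner_scaler.
HB.instance Definition _ := isHermitianSesquilinear.Build (scalar R k)
  (cs_elt M) false (@conjK R k) cs_inner cs_inner_herm.
HB.instance Definition _ := isDotProduct.Build (scalar R k) (cs_elt M)
  cs_inner cs_inner_gt0.

Lemma cs_inner_norm x : cs_inner x x = `|x| ^+ 2.
Proof. exact: inner_norm. Qed.

HB.instance Definition _ := isHilbert.Build R k (cs_elt M) cs_inner_norm.

End normed.
End closed_subspaces.
Coercion cs_elt : closedSubspace >-> Sortclass.

Definition separable (T : topologicalType) : Prop :=
  exists2 D : set T, countable D & dense D.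

Definition borelType (T : ptopologicalType) := g_sigma_algebraType (@open T).

Section operators.
Variables (R : realType) (k : scalarKind).
Implicit Types E V H : hilbertType R k.

Definition bounded_op E V (f : E -> V) : Prop :=
  exists c : R, forall x, `|f x| <= ofR k c * `|x|.

Definition bounded_below E V (f : E -> V) : Prop :=
  exists2 m : R, 0 < m & forall x, ofR k m * `|x| <= `|f x|.

(* The order of [scalar R k] is such that [0 <= z] forces [z] to be real. *)
Definition positive_op H (f : H -> H) : Prop :=
  (forall x y, inner (f x) y = inner x (f y)) /\ (forall x, 0 <= inner (f x) x).

Definition GBplus H (f : {linear H -> H}) : Prop :=
  [/\ bounded_op f, positive_op f &
      exists g : {linear H -> H}, [/\ bounded_op g, cancel f g & cancel g f]].

(* The value [z] of the adjoint of [f] at [y] is the unique [z] below, which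
   exists as soon as [f] is a bounded linear operator; 0 is a default value. *)
Definition adjoint E V (f : E -> V) (y : V) : E :=
  xget 0 [set z : E | forall x, inner (f x) y = inner x z].

(* Orthogonal projection onto [M], as a map from [H] to [M]; as an operator on
   [H] it is followed by the inclusion [val : M -> H]. *)
Definition proj H (M : closedSubspace H) (f : H) : M :=
  xget 0 [set p : M | forall m : M, inner (f - val p) (val m) = 0].

End operators.

Section integrals.
Variables (R : realType) (k : scalarKind).
Variables (d : measure_display) (X : measurableType d).
Variable mu : {measure set X -> \bar R}.
Local Notation K := (scalar R k).
Implicit Type h : X -> K.

Definition Kmeasurable h : Prop :=
  measurable_fun setT (fun x => reK (h x)) /\
  measurable_fun setT (fun x => imK (h x)).

Definition Kintegrable h : Prop :=
  mu.-integrable setT (fun x => (reK (h x))%:E) /\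
  mu.-integrable setT (fun x => (imK (h x))%:E).

Definition Kintegral h : K :=
  mkK k (\int[mu]_x reK (h x))%R (\int[mu]_x imK (h x))%R.

End integrals.

Section families.
Variables (R : realType) (k : scalarKind) (H : hilbertType R k).
Variables (d : measure_display) (X : measurableType d).
Variable mu : {measure set X -> \bar R}.
Implicit Types (F G : X -> closedSubspace H) (v w : X -> R).

Definition weakly_measurable F : Prop :=
  forall f : H,
    measurable_fun setT (fun x => val (proj (F x) f) : borelType H).

Section one_family.
Variables (F : X -> closedSubspace H) (E : X -> hilbertType R k).
Variables (L : forall x, {linear F x -> E x}) (v : X -> R).
Variable T : {linear H -> H}.

Definition gfusion_integrand (f : H) (x : X) : R :=
  v x ^+ 2 * reK (inner (L x (proj (F x) (T f))) (L x (proj (F x) (T f)))).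

Definition gfusion_bessel (B : R) : Prop :=
  0 < B /\ forall f : H,
    measurable_fun setT (gfusion_integrand f) /\
    (\int[mu]_x (gfusion_integrand f x)%:E <= (B * reK `|f| ^+ 2)%:E)%E.

Definition gfusion_frame : Prop :=
  exists A B : R, 0 < A <= B /\ forall f : H,
    [/\ measurable_fun setT (gfusion_integrand f),
        ((A * reK `|f| ^+ 2)%:E <= \int[mu]_x (gfusion_integrand f x)%:E)%E &
        (\int[mu]_x (gfusion_integrand f x)%:E <= (B * reK `|f| ^+ 2)%:E)%E].

End one_family.

Section pair.
Variables (F G : X -> closedSubspace H) (E : X -> hilbertType R k).
Variables (L : forall x, {linear F x -> E x}).
Variables (M : forall x, {linear G x -> E x}).
Variables (v w : X -> R) (T U : {linear H -> H}).

(* U P_G(x) M_x^* L_x P_F(x) T; the adjoint of [M x] has values in [G x]. *)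
Definition pair_op (x : X) (f : H) : H :=
  U (val (proj (G x) (val (adjoint (M x) (L x (proj (F x) (T f))))))).

Definition pair_integrand (f g : H) (x : X) : scalar R k :=
  ofR k (v x * w x) * inner (pair_op x f) g.

Definition is_pair_frame_operator (S : {linear H -> H}) : Prop :=
  bounded_op S /\ forall f g : H,
    Kintegrable mu (pair_integrand f g) /\
    inner (S f) g = Kintegral mu (pair_integrand f g).

End pair.

Definition resolution_of_identity (Q : X -> H -> H) : Prop :=
  (forall x, linear (Q x) /\ bounded_op (Q x)) /\
  forall f g : H,
    [/\ Kmeasurable (fun x => inner (Q x f) g),
        Kintegrable mu (fun x => inner (Q x f) g) &
        inner f g = Kintegral mu (fun x => inner (Q x f) g)].

End families.

(* Main.v *)
Require Import Defs.
From HB Require Import structures.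
From mathcomp Require Import all_boot all_order all_algebra.
From mathcomp Require Import sesquilinear ring lra.
From mathcomp Require Import all_classical all_reals all_analysis.
From mathcomp Require Import complex.
Set Implicit Arguments.
Unset Strict Implicit.
Unset Printing Implicit Defensive.
Import Order.TTheory GRing.Theory Num.Theory.
Import numFieldNormedType.Exports.
Local Open Scope classical_set_scope.
Local Open Scope ring_scope.

(** The theorem rests on two observations about the frame operator [S], whose
    sesquilinear form is the integral of [v w <Q_x f, g>] with
    [Q_x = U P_G Gamma_x^* Lambda_x P_F T].

    Moving a bounded operator [K] to the other side of the inner product gives
    [<K S f, g> = <S f, K^* g>], which is the integral of [v w <K Q_x f, g>].
    Hence the family [v w K Q_x] resolves the identity exactly when [K S = 1]
    ([resolution_left_inverse]).  So (ii) says that [S] has a bounded left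
    inverse, and for a bounded operator this amounts to being bounded below:
    one direction is [|f| = |K S f| <= c |S f|], the other is
    [bounded_below_left_inverse].

    As [U] is self-adjoint,
    [<Q_x f, g> = <Lambda_x P_F T f, Gamma_x P_G U g>], so
    [2 v w Re <Q_x f, g> <= D v^2 |Lambda_x P_F T f|^2 + w^2 |Gamma_x P_G U g|^2 / D].
    For [g = S f] the left-hand side integrates to [2 |S f|^2], and the Bessel
    bound [D] turns the integral of the last term into at most [|S f|^2]; thus
    [|S f|^2 <= D * int v^2 |Lambda_x P_F T f|^2] ([nrm_frame_op_le]).  If
    [m |f| <= |S f|], this is the lower frame bound with constant [m^2 / D].

    All the existence results needed from Hilbert space theory (projections,
    adjoints, left inverses) are instances of one variational statement: if [A]
    is bounded and bounded below, every bounded functional is of the form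
    [<A ., A z>] ([least_squares]).  The vector [z] minimises
    [|A z|^2 - 2 Re phi z]. *)

(** * The scalar field *)

Section ScalarField.
Variables (R : realType) (k : scalarKind).
Implicit Types (z : Defs.scalar R k) (r s : R).

Lemma reK_mk r s : reK (mkK k r s) = r.
Proof. by case: k. Qed.

Lemma reKD z1 z2 : reK (z1 + z2) = reK z1 + reK z2.
Proof. by case: k z1 z2 => [//|] [a b] [c e]. Qed.

Lemma reKN z : reK (- z) = - reK z.
Proof. by case: k z => [//|] [a b]. Qed.

Lemma reK_ofRM r z : reK (ofR k r * z) = r * reK z.
Proof. by case: k z => [//|] [a b] /=; rewrite mul0r subr0. Qed.

Lemma reK_conj z : reK (conjK z) = reK z.
Proof. by case: k z => [//|] [a b]. Qed.

Lemma ofRM r s : ofR k (r * s) = ofR k r * ofR k s.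
Proof.
case: k => //; apply/eqP; rewrite eq_complex /=.
by rewrite mulr0 mul0r subr0 addr0 mulr0 !eqxx.
Qed.

Lemma ofR0 : ofR k (0 : R) = 0.
Proof. by case: k. Qed.

Lemma ofRN1 : ofR k (-1 : R) = -1.
Proof. by case: k => //; apply/eqP; rewrite eq_complex /= oppr0 !eqxx. Qed.

Lemma ofR_le r s : (ofR k r <= ofR k s :> Defs.scalar R k) = (r <= s).
Proof. by case: k => //; rewrite lecE /= eqxx. Qed.

Lemma ofR_lt r s : (ofR k r < ofR k s) = (r < s).
Proof. by case: k => //; rewrite ltcE /= eqxx. Qed.

Lemma ge0_ofR z : 0 <= z -> z = ofR k (reK z).
Proof.
by case: k z => [//|] [a b]; rewrite lecE /= => /andP[/eqP-> _].
Qed.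

(** An equality in the scalar field reduces to equalities of real parts: test
    the difference against its own conjugate. *)
Lemma conjK_mul_eq0 z : reK (conjK z * z) = 0 -> z = 0.
Proof.
case: k z => [z /eqP|[a b] /= h].
  by rewrite /conjK /= mulf_eq0 orbb => /eqP.
have ab : a ^+ 2 + b ^+ 2 = 0 by rewrite -h; ring.
move/eqP: ab; rewrite paddr_eq0 ?sqr_ge0// !sqrf_eq0 => /andP[/eqP-> /eqP->].
by [].
Qed.

End ScalarField.

(** * The underlying real inner product space *)

Section InnerProduct.
Context {R : realType} {k : scalarKind} {H : hilbertType R k}.
Implicit Types x y z : H.

(** The norm and the inner product take values in the scalar field, whose order
    is only partial in the complex case; estimates are carried out on these
    real-valued versions. *)
Definition nrm x : R := reK `|x|.
Definition rin x y : R := reK (inner x y).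

Lemma normE x : `|x| = ofR k (nrm x).
Proof. exact/ge0_ofR. Qed.

Lemma nrm_ge0 x : 0 <= nrm x.
Proof. by rewrite -(ofR_le k) -normE ofR0. Qed.

Lemma rin_nrm x : rin x x = nrm x ^+ 2.
Proof. by rewrite /rin inner_norm normE expr2 -ofRM /ofR reK_mk expr2. Qed.

Lemma nrm_eq0 x : nrm x = 0 -> x = 0.
Proof. by move=> h; apply/normr0_eq0; rewrite normE h ofR0. Qed.

Lemma innerDl x y z : inner (x + y) z = inner x z + inner y z.
Proof. exact: (linearDl (inner : {dot H for @conjK R k})). Qed.

Lemma innerDr x y z : inner x (y + z) = inner x y + inner x z.
Proof. exact: (linearDr (inner : {dot H for @conjK R k})). Qed.

Lemma innerZl a x y : inner (a *: x) y = a * inner x y.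
Proof. exact: linearl_subproof. Qed.

Lemma innerZr a x y : inner x (a *: y) = conjK a * inner x y.
Proof. exact: linearr_subproof. Qed.

Lemma inner_conj x y : inner x y = conjK (inner y x).
Proof.
rewrite -[RHS]mul1r -[X in X * _](expr0 (-1)).
exact: (hermitian_subproof x y).
Qed.

Lemma rinC x y : rin x y = rin y x.
Proof. by rewrite /rin inner_conj reK_conj. Qed.

Lemma rinDl x y z : rin (x + y) z = rin x z + rin y z.
Proof. by rewrite /rin innerDl reKD. Qed.

Lemma rinZl r x y : rin (ofR k r *: x) y = r * rin x y.
Proof. by rewrite /rin innerZl reK_ofRM. Qed.

Lemma rinNl x y : rin (- x) y = - rin x y.
Proof. by rewrite -scaleN1r -ofRN1 rinZl mulN1r. Qed.

Lemma rinBl x y z : rin (x - y) z = rin x z - rin y z.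
Proof. by rewrite rinDl rinNl. Qed.

Lemma nrmZ r x : nrm (ofR k r *: x) ^+ 2 = r ^+ 2 * nrm x ^+ 2.
Proof. by rewrite -!rin_nrm rinZl rinC rinZl; ring. Qed.

Lemma nrmZ_norm r x : nrm (ofR k r *: x) = `|r| * nrm x.
Proof.
apply/eqP; rewrite -(@eqrXn2 _ 2)// ?mulr_ge0 ?nrm_ge0// nrmZ exprMn.
by rewrite real_normK// num_real.
Qed.

Lemma nrmD_sqr x y : nrm (x + y) ^+ 2 = nrm x ^+ 2 + 2 * rin x y + nrm y ^+ 2.
Proof.
by rewrite -!rin_nrm rinDl [rin x (_ + _)]rinC [rin y (_ + _)]rinC !rinDl;
  rewrite [rin y x]rinC; ring.
Qed.

Lemma nrmN x : nrm (- x) = nrm x.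
Proof. by rewrite /nrm normrN. Qed.

Lemma nrmB_sqr x y : nrm (x - y) ^+ 2 = nrm x ^+ 2 - 2 * rin x y + nrm y ^+ 2.
Proof. by rewrite nrmD_sqr rinC rinNl rinC nrmN; ring. Qed.

(** The Cauchy-Schwarz inequality, from [| |y| x - |x| y |^2 >= 0]. *)
Lemma rin_ler x y : rin x y <= nrm x * nrm y.
Proof.
have h := sqr_ge0 (nrm (ofR k (nrm y) *: x - ofR k (nrm x) *: y)).
rewrite nrmB_sqr !nrmZ rinZl [rin x _]rinC rinZl [rin y x]rinC in h.
have [|x0] := eqVneq (nrm x) 0.
  move=> /[dup] x0 /nrm_eq0 ->.
  by rewrite -[X in rin X _](scale0r x) -ofR0 rinZl mul0r mulr_ge0 ?nrm_ge0.
have [|y0] := eqVneq (nrm y) 0.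
  move=> /[dup] y0 /nrm_eq0 ->.
  by rewrite rinC -[X in rin X _](scale0r x) -ofR0 rinZl mul0r mulr_ge0 ?nrm_ge0.
have p : 0 < nrm x * nrm y by rewrite mulr_gt0// lt_neqAle eq_sym ?x0 ?y0 nrm_ge0.
rewrite -(ler_pM2l p).
nra.
Qed.

Lemma nrm_le_of_rin x (b : R) : 0 <= b -> rin x x <= nrm x * b -> nrm x <= b.
Proof.
move=> b0; have [->//|n0] := eqVneq (nrm x) 0.
by rewrite rin_nrm expr2 ler_pM2l// lt_neqAle eq_sym n0 nrm_ge0.
Qed.

Lemma rin_sqr_le x y : rin x y ^+ 2 <= nrm x ^+ 2 * nrm y ^+ 2.
Proof.
have h1 := rin_ler x y; have h2 := rin_ler (- x) y.
rewrite rinNl nrmN in h2; rewrite -exprMn -subr_ge0 subr_sqr mulr_ge0 ?subr_ge0//.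
by rewrite -[rin x y]opprK subr_ge0.
Qed.

Lemma inner_extl x y : (forall z, inner x z = inner y z) -> x = y.
Proof.
move=> h; apply/eqP; rewrite -subr_eq0; apply/eqP/nrm_eq0/eqP.
by rewrite -sqrf_eq0 -rin_nrm rinBl /rin h subrr.
Qed.

Lemma inner_extr x y : (forall z, inner z x = inner z y) -> x = y.
Proof. by move=> h; apply: inner_extl => z; rewrite inner_conj h -inner_conj. Qed.

End InnerProduct.

(** * The variational principle *)

Section Operators.
Context {R : realType} {k : scalarKind}.
Implicit Types E V W : hilbertType R k.

Lemma nrm_ofRP V W (c : R) (x : V) (y : W) :
  (`|x| <= ofR k c * `|y|) = (nrm x <= c * nrm y).
Proof. by rewrite !normE -ofRM ofR_le. Qed.

Lemma bounded_opP V W (f : V -> W) :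
  bounded_op f <-> exists2 c : R, 0 < c & forall x, nrm (f x) <= c * nrm x.
Proof.
split=> [[c fc]|[c c0 fc]]; last by exists c => x; rewrite nrm_ofRP.
exists (Num.max c 1) => [|x]; first by rewrite lt_max ltr01 orbT.
have := fc x; rewrite nrm_ofRP => /le_trans; apply.
by rewrite ler_wpM2r ?nrm_ge0// le_max lexx.
Qed.

Lemma bounded_op_comp E V W (f : E -> V) (g : V -> W) :
  bounded_op f -> bounded_op g -> bounded_op (g \o f).
Proof.
move=> /bounded_opP[c c0 fc] /bounded_opP[b b0 gb]; apply/bounded_opP.
exists (b * c) => [|x /=]; first exact: mulr_gt0.
by rewrite (le_trans (gb _))// -mulrA ler_pM2l.
Qed.

Lemma bounded_belowP V W (f : V -> W) :
  bounded_below f <-> exists2 m : R, 0 < m & forall x, m * nrm x <= nrm (f x).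
Proof.
by split=> -[m m0 h]; exists m => // x;
  have := h x; rewrite !normE -ofRM ofR_le.
Qed.

Section LeastSquares.
Variables (V W : hilbertType R k) (A : {linear V -> W}) (f : V -> R).
Hypothesis A_bounded : bounded_op A.
Hypothesis A_below : bounded_below A.
Hypothesis fD : {morph f : x y / x + y}.
Hypothesis fZ : forall r x, f (ofR k r *: x) = r * f x.
Hypothesis f_bounded : exists c : R, forall x, f x <= c * nrm x.

Let J x := nrm (A x) ^+ 2 - 2 * f x.
Let j := inf (range J).

Let J_inf : has_inf (range J).
Proof.
split; first by exists (J 0), 0.
have [c fc] := f_bounded; have /bounded_belowP[m m0 Am] := A_below.
exists (- (c / m) ^+ 2) => _ [x _ <-].
have h1 := fc x.
have h2 : (m * nrm x) ^+ 2 <= nrm (A x) ^+ 2.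
  by rewrite lerXn2r ?nnegrE ?mulr_ge0 ?nrm_ge0 ?(ltW m0).
have h3 := sqr_ge0 (m * nrm x - c / m).
have h4 : c / m * m = c by rewrite divfK ?gt_eqF.
rewrite /J; move: (c / m) h3 h4 => q h3 h4; rewrite -h4 in h1; nra.
Qed.

(* The derivative of [J] at [x] in the direction [y], up to a factor 2. *)
Let residual x y := rin (A x) (A y) - f y.

(** If [x] minimises [J] up to [e], then [J (x + t y) - J x], a quadratic
    polynomial in [t], is at least [- e], so its discriminant is controlled.
    Both the Cauchy property of a minimising sequence and the Euler-Lagrange
    equation for its limit come from this estimate. *)
Lemma residual_le e x : J x < j + e -> forall y,
  residual x y ^+ 2 <= e * nrm (A y) ^+ 2.
Proof.
move=> Jx y; have [Ay0|Ay0] := eqVneq (nrm (A y)) 0.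
  have y0 : y = 0.
    have /bounded_belowP[m m0 Am] := A_below; apply/nrm_eq0/eqP.
    by rewrite eq_le nrm_ge0 andbT -(pmulr_rle0 _ m0) -Ay0.
  have f0 : f 0 = 0 by rewrite -(scale0r (0 : V)) -(ofR0 R k) fZ mul0r.
  rewrite /residual y0 raddf0 f0 rinC -(scale0r (0 : W)) -(ofR0 R k) rinZl.
  by rewrite mul0r subrr -rin_nrm rinZl mul0r mulr0 expr0n.
have N0 : 0 < nrm (A y) ^+ 2 by rewrite exprn_gt0// lt_neqAle eq_sym Ay0 nrm_ge0.
set N := nrm (A y) ^+ 2 in N0 *.
have key t : j <= J x + 2 * t * residual x y + t ^+ 2 * N.
  have -> : J x + 2 * t * residual x y + t ^+ 2 * N = J (ofR k t *: y + x).
    rewrite /J linearP fD fZ nrmD_sqr nrmZ rinZl rinC /residual /N; ring.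
  apply: ge_inf; [exact: J_inf.2|by exists (ofR k t *: y + x)].
(* the minimum of the quadratic polynomial in [t] *)
have := key (- residual x y / N).
set d := residual x y.
rewrite -[_ + _ + _](_ : J x - d ^+ 2 / N = _); last by field; rewrite gt_eqF.
move=> h; rewrite -ler_pdivrMr//; lra.
Qed.

(** The two derivatives in the direction [x - y] are small and differ by exactly
    [|A (x - y)|^2]. *)
Lemma almost_minimizers_close (m e : R) x y :
  (forall z, m * nrm z <= nrm (A z)) -> 0 < m ->
  J x < j + e -> J y < j + e -> m ^+ 2 * nrm (x - y) ^+ 2 <= 4 * e.
Proof.
move=> Am m0 Jx Jy.
have rx := residual_le Jx (x - y); have ry := residual_le Jy (x - y).
have NE : nrm (A (x - y)) ^+ 2 = residual x (x - y) - residual y (x - y).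
  by rewrite -rin_nrm {1}raddfB rinBl /residual; ring.
have le4 : nrm (A (x - y)) ^+ 2 <= 4 * e.
  move: rx ry NE; set a := residual _ _; set b := residual _ _.
  set N := nrm _ ^+ 2 => rx ry NE.
  have [->|N0] := eqVneq N 0.
    rewrite mulr_ge0//; have : j <= J x.
      by apply: ge_inf; [exact: J_inf.2|exists x].
    lra.
  have Np : 0 < N by rewrite lt_neqAle eq_sym N0 sqr_ge0.
  rewrite -(ler_pM2l Np) {1 2}NE; have := sqr_ge0 (a + b); nra.
rewrite (le_trans _ le4)// -exprMn.
by rewrite lerXn2r ?nnegrE ?mulr_ge0 ?nrm_ge0 ?(ltW m0).
Qed.

Lemma real_least_squares : exists z, forall y, rin (A z) (A y) = f y.
Proof.
have /bounded_belowP[m m0 Am] := A_below.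
have /bounded_opP[C C0 AC] := A_bounded.
have [x_ xP] : {x_ : nat -> V & forall n, J (x_ n) < j + n.+1%:R^-1}.
  apply: (@choice _ _ (fun n x => J x < j + n.+1%:R^-1)) => n.
  have n0 : 0 < (n.+1%:R^-1 : R) by rewrite invr_gt0.
  by have [_ [x _ <-] xn] := inf_adherent n0 J_inf; exists x.
have small (e : R) n : 0 < e -> (Num.trunc e^-1 <= n)%N -> n.+1%:R^-1 < e :> R.
  move=> e0 en; rewrite invf_plt ?posrE//.
  by rewrite (lt_le_trans (truncnS_gt _))// ler_nat.
have xJ (e : R) n : 0 < e -> (Num.trunc e^-1 <= n)%N -> J (x_ n) < j + e.
  by move=> e0 en; rewrite (lt_trans (xP n))// ltrD2l small.
have /cauchy_cvg/cvg_ex[p /= xp] : cauchy (x_ @ \oo).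
  apply: cauchy_exP => eps eps0.
  have [e e0 epsE] : exists2 e : R, 0 < e & eps = ofR k e.
    exists (reK eps); last exact/ge0_ofR/ltW.
    by rewrite -(ofR_lt k) ofR0 -ge0_ofR// ltW.
  (* half of the value of [q] for which the bound [4 q / m^2] equals [e^2] *)
  pose q := (m * e) ^+ 2 / 8.
  have q0 : 0 < q by rewrite divr_gt0// exprn_gt0// mulr_gt0.
  exists (x_ (Num.trunc q^-1)); exists (Num.trunc q^-1) => // n /= qn.
  rewrite -ball_normE /= normE epsE ofR_lt.
  have := almost_minimizers_close Am m0 (xJ _ _ q0 (leqnn _)) (xJ _ _ q0 qn).
  rewrite /q => h; rewrite -(@ltr_pXn2r _ 2)// ?nnegrE ?nrm_ge0 ?(ltW e0)//.
  have me0 : 0 < m ^+ 2 by rewrite exprn_gt0.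
  rewrite -(ltr_pM2l me0) (le_lt_trans h)//.
  have := mulr_gt0 me0 (exprn_gt0 2 e0).
  rewrite exprMn; lra.
exists p => y; apply/eqP; rewrite -subr_eq0 -/(residual p y) -sqrf_eq0.
rewrite eq_le sqr_ge0 andbT; apply/ler_addgt0Pl => eps eps0; rewrite addr0.
(* [D * e] bounds [residual p y ^+ 2] when [p] is [e]-close to an [e]-almost
   minimiser with [e <= 1]; the summand 1 makes [D] positive. *)
pose D := 2 * (C ^+ 2 + 1) * nrm (A y) ^+ 2 + 1.
have D0 : 0 < D.
  by rewrite ltr_wpDl// mulr_ge0 ?sqr_ge0// mulr_ge0// addr_ge0// sqr_ge0.
pose e := Num.min 1 (eps / D).
have e0 : 0 < e by rewrite lt_min ltr01 divr_gt0.
have [n [pn en]] : exists n, nrm (p - x_ n) < e /\ (Num.trunc e^-1 <= n)%N.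
  move/cvgrPdist_lt : xp => /(_ (ofR k e)).
  rewrite -{1}(ofR0 R k) ofR_lt => /(_ e0) [N _ Ne].
  exists (maxn N (Num.trunc e^-1)); rewrite leq_maxr; split=> //.
  have := Ne (maxn N (Num.trunc e^-1)) (leq_maxl _ _).
  by rewrite /= normE ofR_lt.
have r2 := residual_le (xJ _ _ e0 en) y.
have r1 : residual p y = rin (A (p - x_ n)) (A y) + residual (x_ n) y.
  by rewrite raddfB rinBl /residual; ring.
have r3 : rin (A (p - x_ n)) (A y) ^+ 2 <= C ^+ 2 * e * nrm (A y) ^+ 2.
  rewrite (le_trans (rin_sqr_le _ _))// ler_wpM2r ?sqr_ge0//.
  apply: (@le_trans _ _ ((C * nrm (p - x_ n)) ^+ 2)).
    by rewrite lerXn2r ?nnegrE ?mulr_ge0 ?nrm_ge0// ltW.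
  rewrite exprMn ler_wpM2l ?sqr_ge0// expr2.
  have e1 : e <= 1 by rewrite ge_min lexx.
  have := nrm_ge0 (p - x_ n); nra.
have De : D * e <= eps by rewrite mulrC -ler_pdivlMr// ge_min lexx orbT.
apply: le_trans De; rewrite r1 /D.
have := sqr_ge0 (rin (A (p - x_ n)) (A y) - residual (x_ n) y).
nra.
Qed.

End LeastSquares.
End Operators.

(** * Adjoints, projections and left inverses *)

Section HilbertSpace.
Context {R : realType} {k : scalarKind}.
Implicit Types E V W : hilbertType R k.

(** Scalar-linear functionals with the same real part coincide, so the real
    solution of the variational problem is a solution over the scalar field. *)
Lemma least_squares V W (A : {linear V -> W}) (phi : V -> Defs.scalar R k) :
  bounded_op A -> bounded_below A ->
  (forall a x y, phi (a *: x + y) = a * phi x + phi y) ->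
  (exists c : R, forall x, reK (phi x) <= c * nrm x) ->
  exists z, forall y, inner (A y) (A z) = phi y.
Proof.
move=> Ab Am phi_lin phib.
have phiD x y : phi (x + y) = phi x + phi y.
  by rewrite -{1}[x]scale1r phi_lin mul1r.
have phi0 : phi 0 = 0 by apply: (addrI (phi 0)); rewrite -phiD !addr0.
have phiZ a x : phi (a *: x) = a * phi x by rewrite -[_ *: x]addr0 phi_lin phi0 addr0.
have rphiD : {morph (fun x => reK (phi x)) : x y / x + y}.
  by move=> x y; rewrite phiD reKD.
have rphiZ r x : reK (phi (ofR k r *: x)) = r * reK (phi x).
  by rewrite phiZ reK_ofRM.
have [z zP] := real_least_squares Ab Am rphiD rphiZ phib.
exists z => y; apply/eqP; rewrite -subr_eq0; apply/eqP/conjK_mul_eq0.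
set a := _ - _; rewrite mulrBr reKD reKN -innerZl -phiZ -linearZ /=.
by rewrite -/(rin _ _) rinC zP subrr.
Qed.

Lemma riesz V (phi : V -> Defs.scalar R k) :
  (forall a x y, phi (a *: x + y) = a * phi x + phi y) ->
  (exists c : R, forall x, reK (phi x) <= c * nrm x) ->
  exists z, forall y, inner y z = phi y.
Proof.
move=> phi_lin phib.
have [||z zP] := @least_squares _ _ (idfun : {linear V -> V}) phi _ _ phi_lin phib.
- by apply/bounded_opP; exists 1 => // x; rewrite mul1r.
- by apply/bounded_belowP; exists 1 => // x; rewrite mul1r.
by exists z.
Qed.

Lemma inner_comp_bounded V W (A : V -> W) y : bounded_op A ->
  exists c : R, forall x, reK (inner (A x) y) <= c * nrm x.
Proof.
move=> /bounded_opP[c c0 Ac]; exists (c * nrm y) => x.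
rewrite (le_trans (rin_ler _ _))// mulrAC ler_wpM2r ?nrm_ge0//.
Qed.

Lemma adjointP V W (A : {linear V -> W}) x y :
  bounded_op A -> inner (A x) y = inner x (adjoint A y).
Proof.
move=> Ab; have [|z zP] := @riesz _ (fun x => inner (A x) y) _ (inner_comp_bounded y Ab).
  by move=> a u w; rewrite linearP innerDl innerZl.
rewrite /adjoint; case: xgetP => [w -> wP|/(_ z) []]; first exact: wP.
by move=> u /=; rewrite zP.
Qed.

Lemma adjoint_linear V W (A : {linear V -> W}) :
  bounded_op A -> linear (adjoint A).
Proof.
move=> Ab a y z; apply: inner_extr => x.
by rewrite -adjointP// !innerDr !innerZr !adjointP.
Qed.

Lemma adjoint_bounded V W (A : {linear V -> W}) :
  bounded_op A -> bounded_op (adjoint A).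
Proof.
move=> Ab; have /bounded_opP[c c0 Ac] := Ab; apply/bounded_opP; exists c => // y.
apply: nrm_le_of_rin; first by rewrite mulr_ge0 ?nrm_ge0// ltW.
rewrite /rin -adjointP// (le_trans (rin_ler _ _))// [leRHS]mulrCA mulrA.
by rewrite ler_wpM2r ?nrm_ge0.
Qed.

Section Projection.
Variables (H : hilbertType R k) (M : closedSubspace H).
Implicit Types (f g : H) (m : M).

(** This identifies the projection with the adjoint of the inclusion of [M],
    from which its linearity and contractivity follow.  The vector is obtained
    by representing the functional [<., f>] inside the Hilbert space [M]. *)
Lemma inner_proj f m : inner f (val m) = inner (Defs.proj M f) m.
Proof.
have [a x y||z zP] := @riesz (M : hilbertType R k) (fun m => inner (val m) f).
- by rewrite linearP innerDl innerZl.
- exists (nrm f) => x; rewrite -/(rin _ _) (le_trans (rin_ler _ _))//.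
  by rewrite mulrC.
have innerBl (p m' : M) :
    inner (f - val p) (val m') = inner f (val m') - inner p m'.
  have -> : f - val p = (-1) *: val p + f by rewrite scaleN1r addrC.
  by rewrite innerDl innerZl mulN1r addrC.
have : [set p : M | forall m : M, inner (f - val p) (val m) = 0] z.
  by move=> u /=; rewrite innerBl inner_conj -zP -inner_conj subrr.
move=> zM; rewrite /Defs.proj; case: xgetP => [p -> pP|/(_ z)//].
by have /eqP := pP m; rewrite innerBl subr_eq0 => /eqP.
Qed.

Lemma proj_val m : Defs.proj M (val m) = m.
Proof. by apply: inner_extl => z; rewrite -inner_proj. Qed.

Lemma proj_linear : linear (Defs.proj M).
Proof.
move=> a f g; apply: inner_extl => z.
by rewrite -inner_proj !innerDl !innerZl !inner_proj.
Qed.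

Lemma nrm_proj_le f : nrm (Defs.proj M f) <= nrm f.
Proof.
apply: nrm_le_of_rin; first exact: nrm_ge0.
by rewrite mulrC {1}/rin -inner_proj; exact: rin_ler.
Qed.

Lemma proj_bounded : bounded_op (Defs.proj M).
Proof. by apply/bounded_opP; exists 1 => // f; rewrite mul1r nrm_proj_le. Qed.

Lemma val_bounded : bounded_op (val : M -> H).
Proof. by apply/bounded_opP; exists 1 => // f; rewrite mul1r. Qed.

End Projection.

(** The left inverse sends [y] to the least squares solution of [A x = y], that
    is [(A^* A)^-1 A^* y].  It is bounded because [A (K y)] is the projection of
    [y] on the range of [A]. *)
Lemma bounded_below_left_inverse V W (A : {linear V -> W}) :
  bounded_op A -> bounded_below A ->
  exists2 K : {linear W -> V}, bounded_op K & cancel A K.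
Proof.
move=> Ab Abl; have /bounded_belowP[m m0 Am] := Abl.
have [K0 K0P] : {K0 : W -> V & forall y x, inner (A x) (A (K0 y)) = inner (A x) y}.
  apply: (@choice _ _ (fun y z => forall x, inner (A x) (A z) = inner (A x) y)) => y.
  apply: (@least_squares _ _ A (fun x => inner (A x) y) Ab Abl).
    by move=> a u w; rewrite linearP innerDl innerZl.
  exact: inner_comp_bounded.
have uniq z z' : (forall x, inner (A x) (A z) = inner (A x) (A z')) -> z = z'.
  move=> zz'; apply/eqP; rewrite -subr_eq0; apply/eqP/nrm_eq0/eqP.
  rewrite eq_le nrm_ge0 andbT -(pmulr_rle0 _ m0) (le_trans (Am _))//.
  rewrite -(@ler_pXn2r _ 2)// ?nnegrE ?nrm_ge0// expr0n /= -rin_nrm {2}raddfB.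
  by rewrite rinC rinBl ![rin (A _) (A (_ - _))]rinC /rin zz' subrr.
have K0_lin : linear K0.
  move=> a y z; apply: uniq => x.
  by rewrite K0P [A (_ + _)]linearP !innerDr !innerZr !K0P.
pose Kmx := GRing.isLinear.Build _ _ _ _ K0 K0_lin.
pose K : {linear W -> V} := HB.pack K0 Kmx.
exists K; last by move=> x; apply: uniq => z; rewrite K0P.
apply/bounded_opP; exists m^-1 => [|y]; first by rewrite invr_gt0.
rewrite ler_pdivlMl// (le_trans (Am _))//.
apply: nrm_le_of_rin; first exact: nrm_ge0.
by rewrite {1}/rin K0P; exact: rin_ler.
Qed.

End HilbertSpace.

(** * The operators of the pair *)

Section PairOperator.
Context {R : realType} {k : scalarKind} {H : hilbertType R k}.
Context {d : measure_display} {X : measurableType d}.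
Context {F G : X -> closedSubspace H} {E : X -> hilbertType R k}.
Variables (L : forall x, {linear F x -> E x}).
Variables (M : forall x, {linear G x -> E x}).
Variables (T U : {linear H -> H}).
Hypothesis L_bounded : forall x, bounded_op (L x).
Hypothesis M_bounded : forall x, bounded_op (M x).
Hypothesis T_bounded : bounded_op T.
Hypothesis U_bounded : bounded_op U.
Local Notation Q := (pair_op L M T U).

Lemma pair_op_linear x : linear (Q x).
Proof.
move=> a f g; rewrite /pair_op !proj_val linearP proj_linear linearP.
by rewrite adjoint_linear// !linearP.
Qed.

Lemma pair_op_bounded x : bounded_op (Q x).
Proof.
rewrite [Q x](_ : _ = U \o val \o adjoint (M x) \o L x \o Defs.proj (F x) \o T).
  apply: bounded_op_comp T_bounded _; apply: bounded_op_comp (proj_bounded _) _.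
  apply: bounded_op_comp (L_bounded x) _.
  apply: bounded_op_comp (adjoint_bounded (M_bounded x)) _.
  exact: bounded_op_comp (val_bounded _) U_bounded.
by apply/funext => f; rewrite /pair_op proj_val.
Qed.

Lemma inner_pair_op x f g : (forall y z, inner (U y) z = inner y (U z)) ->
  inner (Q x f) g =
  inner (L x (Defs.proj (F x) (T f))) (M x (Defs.proj (G x) (U g))).
Proof.
move=> Us; rewrite /pair_op proj_val Us inner_conj inner_proj.
by rewrite -adjointP// -inner_conj.
Qed.

End PairOperator.

(** * Frame inequalities *)

Section BesselFamily.
Context {R : realType} {k : scalarKind} {H : hilbertType R k}.
Context {d : measure_display} {X : measurableType d}.
Context {F : X -> closedSubspace H} {E : X -> hilbertType R k}.
Variables (L : forall x, {linear F x -> E x}) (v : X -> R) (T : {linear H -> H}).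
Variable mu : {measure set X -> \bar R}.

Lemma gfusion_integrand_ge0 f x : 0 <= gfusion_integrand L v T f x.
Proof.
by rewrite /gfusion_integrand mulr_ge0 ?sqr_ge0// -/(rin _ _) rin_nrm sqr_ge0.
Qed.

Lemma bessel_integrable B f : gfusion_bessel mu L v T B ->
  mu.-integrable setT (EFin \o gfusion_integrand L v T f).
Proof.
move=> [B0 /(_ f) [mf fB]]; apply/integrableP; split; first exact/measurable_realfun.measurable_EFinP.
under eq_integral do rewrite /= ger0_norm ?gfusion_integrand_ge0//.
exact: le_lt_trans fB (ltry _).
Qed.

End BesselFamily.

Section FrameOperator.
Context {R : realType} {k : scalarKind} {H : hilbertType R k}.
Context {d : measure_display} {X : measurableType d}.
Context {F G : X -> closedSubspace H} {E : X -> hilbertType R k}.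
Variables (L : forall x, {linear F x -> E x}).
Variables (M : forall x, {linear G x -> E x}).
Variables (T U S : {linear H -> H}) (mu : {measure set X -> \bar R}).
Variables (v w : X -> R).
Hypothesis M_bounded : forall x, bounded_op (M x).
Hypothesis S_frame : is_pair_frame_operator mu L M v w T U S.

(** Weighting the pointwise inequality [2 Re <a, b> <= D |a|^2 + |b|^2 / D] by the
    Bessel bound [D] of the second family makes its integral for [g = S f] at
    most [|S f|^2], which half of the left-hand side absorbs. *)
Lemma nrm_frame_op_le (B D : R) f :
  (forall y z, inner (U y) z = inner y (U z)) ->
  gfusion_bessel mu L v T B -> gfusion_bessel mu M w U D ->
  ((nrm (S f) ^+ 2)%:E <= D%:E * \int[mu]_x (gfusion_integrand L v T f x)%:E)%E.
Proof.
move=> Us Lb Mb; have [D0 /(_ (S f)) [_ MD]] := Mb.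
have Li := bessel_integrable f Lb.
have Mi := bessel_integrable (S f) Mb.
have [_ /(_ f (S f)) [[Pi _] SE]] := S_frame.
rewrite -(fineK (integrable_fin_num measurableT Li)) -EFinM lee_fin.
rewrite -(fineK (integrable_fin_num measurableT Mi)) lee_fin in MD.
set I := fine _; set I' := fine _ in MD.
have SP : nrm (S f) ^+ 2 = (\int[mu]_x reK (pair_integrand L M v w T U f (S f) x))%R.
  by rewrite -rin_nrm /rin SE reK_mk.
have : 2 * nrm (S f) ^+ 2 <= D * I + D^-1 * I'.
  rewrite SP /I /I' -!RintegralZl// -RintegralD//; last 2 first.
  - exact: (integrableZl measurableT D Li).
  - exact: (integrableZl measurableT D^-1 Mi).
  apply: le_Rintegral => //.
  - exact: (integrableZl measurableT 2 Pi).
  - exact: (integrableD measurableT (integrableZl measurableT D Li)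
      (integrableZl measurableT D^-1 Mi)).
  move=> x _; rewrite /pair_integrand reK_ofRM inner_pair_op//.
  rewrite /gfusion_integrand -!/(rin _ _) !rin_nrm.
  set a := L x _; set b := M x _.
  have h : 0 <= D^-1 * nrm (ofR k (D * v x) *: a - ofR k (w x) *: b) ^+ 2.
    by rewrite mulr_ge0 ?sqr_ge0// invr_ge0 ltW.
  rewrite -subr_ge0 (le_trans h)// nrmB_sqr !nrmZ rinZl [rin a _]rinC rinZl.
  rewrite [rin b a]rinC le_eqVlt; apply/orP; left; apply/eqP.
  by field; rewrite gt_eqF.
have : D^-1 * I' <= nrm (S f) ^+ 2 by rewrite ler_pdivrMl.
lra.
Qed.

Lemma bounded_below_frame (B D : R) :
  (forall y z, inner (U y) z = inner y (U z)) ->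
  gfusion_bessel mu L v T B -> gfusion_bessel mu M w U D ->
  bounded_below S -> gfusion_frame mu L v T.
Proof.
move=> Us Lb Mb /bounded_belowP[m m0 Sm].
have [D0 _] := Mb; have [B0 LB] := Lb.
(* The maximum ensures that the lower constant does not exceed the upper one
   when [H] is trivial. *)
exists (m ^+ 2 / D), (Num.max B (m ^+ 2 / D)); split.
  by rewrite le_max lexx orbT andbT divr_gt0// exprn_gt0.
move=> f; have [mf fB] := LB f; split=> //.
  have := nrm_frame_op_le f Us Lb Mb.
  rewrite -lee_pdivrMl// => /(le_trans _); apply; rewrite -EFinM lee_fin.
  rewrite -/(nrm f) mulrAC mulrC ler_pM2l ?invr_gt0// -exprMn.
  by rewrite lerXn2r ?nnegrE ?mulr_ge0 ?nrm_ge0// ltW.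
rewrite (le_trans fB)// lee_fin ler_wpM2r ?sqr_ge0//.
by rewrite le_max lexx.
Qed.

Hypothesis L_bounded : forall x, bounded_op (L x).
Hypothesis T_bounded : bounded_op T.
Hypothesis U_bounded : bounded_op U.

(** Both sides compare [<f, g>] with [<K S f, g> = <S f, K^* g>], the integral of
    the pair integrand at [f] and [K^* g]. *)
Lemma resolution_left_inverse (K : {linear H -> H}) : bounded_op K ->
  resolution_of_identity mu
    (fun x f => ofR k (v x * w x) *: K (pair_op L M T U x f)) <-> cancel S K.
Proof.
move=> Kb.
(* the weighted family has the pair integrand at [K^* g] as its coefficients *)
have QE f g : (fun x => inner (ofR k (v x * w x) *: K (pair_op L M T U x f)) g) =
    pair_integrand L M v w T U f (adjoint K g).
  by apply/funext => x; rewrite innerZl /pair_integrand -adjointP.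
have SE f g : inner (K (S f)) g =
    Kintegral mu (pair_integrand L M v w T U f (adjoint K g)).
  by rewrite adjointP//; have [_ /(_ f (adjoint K g)) []] := S_frame.
split=> [[_ QI] f|KS].
  by apply: inner_extl => g; have [_ _ ->] := QI f g; rewrite SE QE.
split=> [x|f g].
  split=> [a f g|].
    by rewrite pair_op_linear// [K _]linearP scalerDr !scalerA mulrC.
  have Qb := pair_op_bounded L_bounded M_bounded T_bounded U_bounded x.
  have KQb := bounded_op_comp Qb Kb.
  apply: (bounded_op_comp KQb).
  by exists (`|v x * w x|) => f; rewrite nrm_ofRP nrmZ_norm.
rewrite QE; have [_ /(_ f (adjoint K g)) [PI _]] := S_frame.
split=> //; last by rewrite -SE KS.
by case: PI => /measurable_int + /measurable_int +; split; apply/measurable_realfun.measurable_EFinP.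
Qed.

End FrameOperator.

Theorem theorem4p5 (R : realType) (k : scalarKind) (H : hilbertType R k)
  (H_sep : separable H)
  (d : measure_display) (X : measurableType d) (mu : {measure set X -> \bar R})
  (T U : {linear H -> H}) (T_GB : GBplus T) (U_GB : GBplus U)
  (F G : X -> closedSubspace H)
  (F_meas : weakly_measurable F) (G_meas : weakly_measurable G)
  (v w : X -> R)
  (v_meas : measurable_fun setT v) (w_meas : measurable_fun setT w)
  (v_ge0 : forall x, 0 <= v x) (w_ge0 : forall x, 0 <= w x)
  (K_ : X -> hilbertType R k)
  (Lambda : forall x, {linear F x -> K_ x})
  (Gamma : forall x, {linear G x -> K_ x})
  (Lambda_bounded : forall x, bounded_op (Lambda x))
  (Gamma_bounded : forall x, bounded_op (Gamma x))
  (B D : R)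
  (Lambda_bessel : gfusion_bessel mu Lambda v T B)
  (Gamma_bessel : gfusion_bessel mu Gamma w U D)
  (S : {linear H -> H})
  (S_frame_op : is_pair_frame_operator mu Lambda Gamma v w T U S) :
  let resolves (Kop : {linear H -> H}) :=
    bounded_op Kop /\
    resolution_of_identity mu
      (fun x f => ofR k (v x * w x) *: Kop (pair_op Lambda Gamma T U x f)) in
  (bounded_below S <-> exists Kop : {linear H -> H}, resolves Kop) /\
  (bounded_below S \/ (exists Kop : {linear H -> H}, resolves Kop) ->
   gfusion_frame mu Lambda v T).
Proof.
move=> resolves; have [Tb _ _] := T_GB; have [Ub [Us _] _] := U_GB.
have resP (K : {linear H -> H}) : bounded_op K ->
    resolution_of_identity mu
      (fun x f => ofR k (v x * w x) *: K (pair_op Lambda Gamma T U x f)) <->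
    cancel S K.
  exact: resolution_left_inverse.
have below_iff : bounded_below S <-> exists K, resolves K.
  split=> [Sbl|[K [Kb /(resP K Kb) KS]]].
    have [K Kb KS] := bounded_below_left_inverse S_frame_op.1 Sbl.
    by exists K; split=> //; exact/resP.
  have /bounded_opP[c c0 Kc] := Kb; apply/bounded_belowP.
  exists c^-1 => [|f]; first by rewrite invr_gt0.
  by rewrite ler_pdivrMl//; have := Kc (S f); rewrite KS.
split=> // res; have Sbl : bounded_below S by case: res => // /below_iff.
exact: bounded_below_frame Us Lambda_bessel Gamma_bessel Sbl.
Qed.
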